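(* Let $H$ be a finite, simple, connected graph with universal cover $\pi\colon T\to H$. Let $M$ be a bounded operator on $\ell^2(V(T))$ which is symmetric, local, connected and pulled back from $H$. If there is a finite ratio system $r$ for $M$ with $\alpha(r)=1$, then $M$ does not have a bounded inverse.
   Context: $E(H)$ is the set of directed edges, with $(u,v)^{-1}=(v,u)$. For directed edges, $e\to f$ means the head of $e$ is the tail of $f$ and $f\neq e^{-1}$. The universal cover $\pi\colon T\to H$ is a tree $T$ with a homomorphism $\pi$ restricting to a bijection between the edges at $x$ and the edges at $\pi(x)$, for every vertex $x$. For $M$ bounded on $\ell^2(V(T))$ let $M_{xy}=\langle\delta_x,M\delta_y\rangle$. We say $M$ is: - symmetric if $\overline{M}^*=M$; - local if $M_{xy}=0$ at distance $>1$; - connected if $M_{xy}\neq0$ at distance $1$; - pulled back if $M_{xy}$ depends only on $(\pi(x),\pi(y))$ when $x=y$ or $x\sim y$. Write $m_{ab}$ for this common value and $m_e=m_{ab}$ for $e=(a,b)\in E(H)$. A finite ratio system for $M$ is a function $r\colon E(H)\to\mathbb{C}\setminus\{0\}$ such that for every $e=(u,v)\in E(H)$: $$0=m_{vv}+\frac{m_{e^{-1}}}{r_e}+\sum_{e'\colon e\to e'}m_{e'}r_{e'}.$$ Its decay rate $\alpha(r)$ is the Perron eigenvalue (spectral radius) of the nonnegative matrix $R$ indexed by $E(H)$, with $R_{e,f}=|r_f|^2$ if $e\to f$ and $R_{e,f}=0$ otherwise. *)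

(* Defs.v *)
From HB Require Import structures.
From mathcomp Require Import all_boot all_order all_algebra.
From mathcomp Require Import all_classical all_reals all_analysis.
From mathcomp.analysis.showcase Require summability.
From mathcomp Require Import ring.
From mathcomp.real_closed Require Import complex.

Set Implicit Arguments.
Unset Strict Implicit.
Unset Printing Implicit Defensive.

Import Order.TTheory GRing.Theory Num.Theory.
Import numFieldNormedType.Exports.
Import Normc.

Local Open Scope classical_set_scope.
Local Open Scope ring_scope.

Record sgraph (V : Type) := SGraph {
  adj :> rel V;
  adj_sym : symmetric adj;
  adj_irr : irreflexive adj }.

Section Graphs.
Variable V : choiceType.
Implicit Type G : sgraph V.

(* The vertex set of a connected graph is required to be nonempty. *)
Definition connected_graph G :=
  (exists x : V, True) /\
  forall x y : V, exists p : seq V, path G x p /\ last x p = y.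

Definition acyclic_graph G :=
  forall c : seq V, cycle G c -> uniq c -> (size c < 3)%N.

Definition tree G := connected_graph G /\ acyclic_graph G.

Definition has_walk G (x y : V) (n : nat) : bool :=
  `[< exists p : seq V, [/\ path G x p, last x p = y & size p = n] >].

(* Graph distance; it is 0 when x and y lie in different components. *)
Definition gdist G (x y : V) : nat :=
  if pselect (exists n, has_walk G x y n) is left h then ex_minn h else 0%N.

End Graphs.

(* As the graphs are simple, the edges at x are identified with the
   neighbours of x. *)
Definition universal_cover (V W : choiceType) (T : sgraph V) (H : sgraph W)
    (pi : V -> W) :=
  [/\ tree T,
      forall x y, T x y -> H (pi x) (pi y)
    & forall x, set_bij [set y | T x y] [set b | H (pi x) b] pi].

Section DirectedEdges.
Variables (W : finType) (H : sgraph W).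

Definition dedge := {e : W * W | H e.1 e.2}.

Definition etail (e : dedge) : W := (val e).1.
Definition ehead (e : dedge) : W := (val e).2.

Lemma erev_subproof (e : dedge) : H (ehead e) (etail e).
Proof. by rewrite adj_sym; exact: (valP e). Qed.

Definition erev (e : dedge) : dedge :=
  exist _ (ehead e, etail e) (erev_subproof e).

Definition follows (e f : dedge) : bool :=
  (ehead e == etail f) && (f != erev e).

End DirectedEdges.

Section Ell2.
Variables (R : realType) (V : choiceType).

Definition square_summable : {pred V -> R[i]} :=
  mem [set f : V -> R[i] |
        (\esum_(x in [set: V]) ((normc (f x)) ^+ 2)%:E < +oo)%E].

Lemma square_summable_le (f g h : V -> R[i]) (a b : R) :
  0 <= a -> 0 <= b -> f \in square_summable -> g \in square_summable ->
  (forall x, normc (h x) ^+ 2 <= a * normc (f x) ^+ 2 + b * normc (g x) ^+ 2) ->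
  h \in square_summable.
Proof.
move=> a0 b0; rewrite !inE /= => Hf Hg Hh.
have scale c (k : V -> R[i]) : 0 <= c ->
    (\esum_(x in [set: V]) ((normc (k x)) ^+ 2)%:E < +oo)%E ->
    (\esum_(x in [set: V]) (c * (normc (k x)) ^+ 2)%:E < +oo)%E.
  move=> c0 Hk.
  apply: (@le_lt_trans _ _
    (c%:E * \esum_(x in [set: V]) ((normc (k x)) ^+ 2)%:E)%E).
    apply: ge_ereal_sup => _ [X [finX _]] <-.
    under eq_fsbigr do rewrite EFinM.
    rewrite -ge0_mule_fsumr; last by move=> x; rewrite lee_fin sqr_ge0.
    by apply: lee_wpmul2l; rewrite ?lee_fin//; apply: esum_ge; exists X.
  by apply: lte_mul_pinfty; rewrite ?lee_fin.
apply: (@le_lt_trans _ _ (\esum_(x in [set: V])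
   ((a * normc (f x) ^+ 2)%:E + (b * normc (g x) ^+ 2)%:E))%E).
  by apply: le_esum => x _; rewrite -EFinD lee_fin Hh.
rewrite esumD; try by move=> x _; rewrite lee_fin mulr_ge0 ?sqr_ge0.
by rewrite lte_add_pinfty// scale.
Qed.

Lemma square_summable0 : (0 : V -> R[i]) \in square_summable.
Proof.
rewrite inE /= esum1// => x _.
by have /= -> := normc0 R; rewrite expr0n.
Qed.

Lemma square_summable_submod_closed : submod_closed square_summable.
Proof.
split=> [|a f g Hf Hg]; first exact: square_summable0.
apply: (@square_summable_le f g _ (2 * normc a ^+ 2) 2) => //.
  by rewrite mulr_ge0 ?sqr_ge0.
move=> x; rewrite -mulrA -exprMn -normcM.
apply: (@le_trans _ _ ((normc (a * f x) + normc (g x)) ^+ 2)).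
  have n0 z : 0 <= normc z :> R by case: z => u v; rewrite sqrtr_ge0.
  rewrite ler_sqr ?nnegrE ?addr_ge0//.
  exact: (@le_normcD R (a * f x) (g x)).
rewrite -subr_ge0 (_ : _ - _ = (normc (a * f x) - normc (g x)) ^+ 2) ?sqr_ge0//.
by ring.
Qed.

HB.instance Definition _ := GRing.isSubmodClosed.Build _ _ square_summable
  square_summable_submod_closed.

Record ell2 := Ell2 {
  ell2_fun :> V -> R[i];
  ell2_funP : ell2_fun \in square_summable }.

HB.instance Definition _ := [isSub for ell2_fun].
HB.instance Definition _ := [Choice of ell2 by <:].
HB.instance Definition _ := [SubChoice_isSubLmodule of ell2 by <:].


Implicit Types f g : ell2.

Definition ell2_norm f : R :=
  Num.sqrt (fine (\esum_(x in [set: V]) ((normc (f x)) ^+ 2)%:E)%E).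

(* Conjugate-linear in the first argument; the sum over V is the limit of the
   net of finite partial sums. *)
Definition ell2_inner f g : R[i] :=
  summability.sum (fun x : V => (conjc (f x) * g x : R[i]^o)).

Lemma ell2_delta_subproof (x : V) :
  (fun y => (y == x)%:R : R[i]) \in square_summable.
Proof.
rewrite inE /=.
rewrite (_ : (fun y => _) =
   (fun y => if y \in [set x] then 1%:E else 0%E)); last first.
  apply/funext => y; have [->|/eqP yx] := eqVneq y x.
    by rewrite mem_set// normc1 expr1n.
  by rewrite memNset// normc0 expr0n.
rewrite -(esum_mkcond [set x] (fun=> 1%:E)) esum_set1 ?lee_fin//.
exact: ltry.
Qed.

Definition ell2_delta (x : V) : ell2 := Ell2 (ell2_delta_subproof x).

Lemma ell2_conj_subproof f : (fun x => conjc (f x)) \in square_summable.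
Proof.
apply: (@square_summable_le f f _ 1 0) => //; try exact: ell2_funP.
move=> x; rewrite mul1r mul0r addr0.
by case: (f x) => a b /=; rewrite sqrrN.
Qed.

Definition ell2_conj f : ell2 := Ell2 (ell2_conj_subproof f).

Definition bounded_op (A : ell2 -> ell2) :=
  exists C : R, forall f, ell2_norm (A f) <= C * ell2_norm f.

Definition conj_op (A : ell2 -> ell2) : ell2 -> ell2 :=
  fun f => ell2_conj (A (ell2_conj f)).

(* B is the adjoint of A *)
Definition is_adjoint (A B : ell2 -> ell2) :=
  forall f g, ell2_inner (B f) g = ell2_inner f (A g).

(* The transpose, not the Hermitian adjoint, of A is A: on entries this reads
   A_xy = A_yx. *)
Definition symmetric_op (A : ell2 -> ell2) := is_adjoint (conj_op A) A.

Definition entry (A : ell2 -> ell2) (x y : V) : R[i] :=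
  ell2_inner (ell2_delta x) (A (ell2_delta y)).

Definition has_bounded_inverse (A : ell2 -> ell2) :=
  exists B : {linear ell2 -> ell2},
    [/\ bounded_op B, cancel A B & cancel B A].

End Ell2.

Section TreeOperators.
Variables (R : realType) (V W : choiceType) (T : sgraph V) (pi : V -> W).
Implicit Type A : ell2 R V -> ell2 R V.

Definition local_op A := forall x y, (1 < gdist T x y)%N -> entry A x y = 0.

Definition connected_op A :=
  forall x y, gdist T x y = 1%N -> entry A x y != 0.

Definition pulled_back A :=
  forall x y x' y', x = y \/ T x y -> x' = y' \/ T x' y' ->
    pi x = pi x' -> pi y = pi y' -> entry A x y = entry A x' y'.

(* The common value m_ab of the entries of a pulled back operator above (a, b);
   0 if there is no such entry. *)
Definition base_entry A (a b : W) : R[i] :=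
  xget 0 [set z | exists x y,
    [/\ x = y \/ T x y, pi x = a, pi y = b & z = entry A x y]].

End TreeOperators.

Definition spectral_radius (R : realType) n (A : 'M[R[i]]_n) : R :=
  sup [set normc z | z in [set z : R[i] | eigenvalue A z]].

Section RatioSystems.
Variables (R : realType) (W : finType) (H : sgraph W).
Implicit Type r : dedge H -> R[i].

Definition edge_val (m : W -> W -> R[i]) (e : dedge H) : R[i] :=
  m (etail e) (ehead e).

Definition finite_ratio_system (m : W -> W -> R[i]) r :=
  (forall e, r e != 0) /\
  forall e : dedge H,
    0 = m (ehead e) (ehead e) + edge_val m (erev e) / r e
        + \sum_(f | follows e f) edge_val m f * r f.

Definition ratio_matrix r : 'M[R[i]]_#|{: dedge H}| :=
  \matrix_(i, j) if follows (enum_val i) (enum_val j)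
                 then `|r (enum_val j)| ^+ 2 else 0.

Definition decay_rate r : R := spectral_radius (ratio_matrix r).

End RatioSystems.

(* Main.v *)
(* A bounded inverse forces |F| <= C |M F| for all F. Over a directed edge e, let
   F_n be the product of the ratios along paths starting at e, cut off at
   distance n. The ratio equation makes M F_n vanish except near the root and in
   the last two layers. If a_k(e) is the total squared weight of the k-th layer,
   this gives a_0(e) + ... + a_n(e) <= D (1 + a_n(e)). As a_n = R^n 1 and R has
   spectral radius 1, a_n grows subexponentially, so the partial sums are bounded
   by D. But an eigenvector v with an eigenvalue of modulus 1 satisfies
   |v| <= |v| R, so the |v|-weighted mean of a_n does not decay: contradiction. *)
Require Import Defs.
From HB Require Import structures.
From mathcomp Require Import finmap.
From mathcomp Require Import all_boot all_order all_algebra.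
From mathcomp Require Import all_classical all_reals all_analysis.
From mathcomp.real_closed Require Import complex.
From mathcomp Require Import ring lra.

Set Implicit Arguments.
Unset Strict Implicit.
Unset Printing Implicit Defensive.

Import Order.TTheory GRing.Theory Num.Theory.
Import numFieldNormedType.Exports.
Import Normc.

Local Open Scope classical_set_scope.
Local Open Scope ring_scope.

(** * The modulus of a complex number *)

Section ComplexModulus.
Variable R : realType.
Implicit Types x y : R[i].

Lemma normc_ge0 x : 0 <= normc x.
Proof. by case: x => a b; rewrite sqrtr_ge0. Qed.

Lemma normc_triangle x y : normc (x + y) <= normc x + normc y.
Proof. exact: (@le_normcD R x y). Qed.

Lemma normc_opp x : normc (- x) = normc x.
Proof. exact: (@normcN R x). Qed.

Lemma normc_sum (I : Type) (s : seq I) (P : pred I) (F : I -> R[i]) :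
  normc (\sum_(i <- s | P i) F i) <= \sum_(i <- s | P i) normc (F i).
Proof.
elim/big_rec2: _ => [|i y1 y2 _ h]; first by rewrite normc0.
by apply: le_trans (normc_triangle _ _) _; rewrite lerD2l.
Qed.

Lemma normc_real (a : R) : 0 <= a -> normc a%:C%C = a.
Proof. by move=> a0; rewrite /= expr0n /= addr0 sqrtr_sqr ger0_norm. Qed.

End ComplexModulus.

(** * Spectral radius, growth of powers and moduli of eigenvectors *)

Section SpectralRadius.
Variable R : realType.

Lemma char_poly_splits n (A : 'M[R[i]]_n) :
  exists s : seq R[i], char_poly A = \prod_(z <- s) ('X - z%:P).
Proof.
have [s ->] := closed_field_poly_normal (char_poly A); exists s.
by rewrite (monicP (char_poly_monic A)) scale1r.
Qed.

(** The eigenvalues are the finitely many roots of the characteristic polynomial, so the supremum is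
    a maximum once one exists. Positivity supplies one, as [sup set0] is 0. *)
Lemma spectral_radius_attained n (A : 'M[R[i]]_n) :
  0 < spectral_radius A ->
  (forall z, eigenvalue A z -> normc z <= spectral_radius A) /\
  exists2 z, eigenvalue A z & normc z = spectral_radius A.
Proof.
rewrite /spectral_radius.
set S := [set normc z | z in [set z | eigenvalue A z]] => S_gt0.
have [s charE] := char_poly_splits A.
have eigE z : eigenvalue A z = (z \in s).
  by rewrite eigenvalue_root_char charE root_prod_XsubC.
have [z zA z_max] : exists2 z, eigenvalue A z &
    forall t, eigenvalue A t -> normc t <= normc z.
  have [z0 z0A] : exists z, eigenvalue A z.
    apply: contrapT => noeig; move: S_gt0.
    rewrite (_ : S = set0) ?sup0 ?ltxx// -subset0 => t [z zA zt].
    by apply: noeig; exists z.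
  have s_max (s' : seq R[i]) : s' != [::] ->
      exists2 z, z \in s' & {in s', forall t, normc t <= normc z}.
    elim: s' => // x [|y s'] IH _.
      by exists x; rewrite ?mem_head// => t; rewrite inE => /eqP->.
    have [z zs z_max] := IH isT.
    have [xz|/ltW zx] := leP (normc x) (normc z).
      exists z; first by rewrite inE zs orbT.
      by move=> t; rewrite inE => /predU1P[->//|/z_max].
    exists x; first exact: mem_head.
    by move=> t; rewrite inE => /predU1P[->//|/z_max/le_trans]; apply.
  have s0 : s != [::].
    by apply: contraTneq z0A => s0; rewrite eigE s0.
  have [z zs z_max] := s_max s s0.
  by exists z; rewrite ?eigE// => t; rewrite eigE; apply: z_max.
suff -> : sup S = normc z by split=> //; exists z.
have ubS : ubound S (normc z) by move=> _ [t /z_max tz <-].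
have Sz : S (normc z) by exists z.
by apply/le_anti; rewrite ge_sup ?ub_le_sup//; exists (normc z).
Qed.

(* Cayley-Hamilton: peel off one linear factor of the characteristic polynomial
   at a time; each x_{k+1} = z x_k + y_k with |z| <= 1 preserves the rate q. *)
Lemma power_growth n (A : 'M[R[i]]_n) (Y : 'cV[R[i]]_n) (q : R) :
  1 < q -> (forall z, eigenvalue A z -> normc z <= 1) ->
  exists2 K : R, 0 <= K & forall k i, normc ((A ^+ k *m Y) i 0) <= K * q ^+ k.
Proof.
move=> q1; case: n A Y => [|n] A Y eig1; first by exists 0 => // k [].
have [s charE] := char_poly_splits A.
have s1 : {in s, forall z, normc z <= 1}.
  move=> z zs; apply: eig1.
  by rewrite eigenvalue_root_char charE root_prod_XsubC.
have : horner_mx A (\prod_(z <- s) ('X - z%:P)) *m Y = 0.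
  by rewrite -charE Cayley_Hamilton mul0mx.
elim: s s1 Y {charE} => [|z s IH] s1 Y.
  rewrite big_nil rmorph1 mul1mx => ->; exists 0 => // k i.
  by rewrite mulmx0 mxE normc0 mul0r.
have z1 : normc z <= 1 by rewrite s1 ?mem_head.
have s1' : {in s, forall t, normc t <= 1}.
  by move=> t ts; rewrite s1 // inE ts orbT.
(* The vector [(A - z) Y] is annihilated by the remaining factors, so the induction hypothesis
   applies to it. *)
rewrite big_cons mulrC rmorphM /= -mulmxA => /(IH s1').
rewrite rmorphB /= horner_mx_X horner_mx_C mulmxBl => -[K K0 KP].
(* The sum covers [k = 0]; the term [K / (q - 1)] ensures [K' + K <= K' q], which carries the bound
   from [k] to [k + 1]. *)
pose K' := \sum_i normc (Y i 0) + K / (q - 1).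
have q10 : 0 < q - 1 by rewrite subr_gt0.
have Y0 : 0 <= \sum_i normc (Y i 0) by apply: sumr_ge0 => i _; exact: normc_ge0.
have K'0 : 0 <= K' by rewrite addr_ge0// divr_ge0// ltW.
exists K' => //; elim=> [|k IHk] i.
  rewrite expr0 mul1mx mulr1 (le_trans _ (_ : \sum_i normc (Y i 0) <= _))//.
    by rewrite (bigD1 i)//= lerDl sumr_ge0// => j _; exact: normc_ge0.
  by rewrite lerDl divr_ge0// ltW.
have -> : A ^+ k.+1 *m Y = z *: (A ^+ k *m Y) + A ^+ k *m (A *m Y - z%:M *m Y).
  by rewrite mulmxBr mul_scalar_mx -scalemxAr addrC subrK exprSr -mulmxA.
rewrite mxE; apply: le_trans (normc_triangle _ _) _.
rewrite mxE normcM (le_trans (lerD (ler_piMl (normc_ge0 _) z1) (KP k i)))//.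
apply: (le_trans (lerD (IHk i) (lexx _))).
rewrite exprS mulrA -mulrDl ler_wpM2r ?exprn_ge0 ?(le_trans ler01 (ltW q1))//.
rewrite -lerBrDl -{2}[K']mulr1 -mulrBr mulrDl divfK ?gt_eqF//.
by rewrite lerDr mulr_ge0// ltW.
Qed.

(** For a left eigenvector [v] and [w = |v|], one has [w_j <= |z| w_j = |(v A)_j|]; the triangle
    inequality does the rest. This inequality stands in for a Perron eigenvector. *)
Lemma eigenvector_modulus n (A : 'M[R[i]]_n) z :
  eigenvalue A z -> 1 <= normc z ->
  exists w : 'I_n -> R, [/\ forall i, 0 <= w i, 0 < \sum_i w i &
    forall j, w j <= \sum_i w i * normc (A i j)].
Proof.
move=> /eigenvalueP[v vA v0] z1; exists (fun i => normc (v 0 i)).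
have w0 i : 0 <= normc (v 0 i) by exact: normc_ge0.
split=> // [|j].
  rewrite lt_neqAle sumr_ge0 ?andbT 1?eq_sym// psumr_eq0//.
  apply: contra v0 => /allP v0; apply/eqP/rowP => i; rewrite mxE.
  by apply/eq0_normc/eqP; rewrite (eqP (v0 i _)) ?mem_index_enum.
apply: (@le_trans _ _ (normc ((z *: v) 0 j))).
  by rewrite mxE normcM ler_peMl.
rewrite -vA mxE; apply: le_trans (normc_sum _ _ _) _.
by apply: ler_sum => i _; rewrite normcM.
Qed.

End SpectralRadius.

(** * Weighted walks on a finite set *)

Section WeightedWalks.
Variables (R : realType) (E : finType) (P : E -> E -> R).
Hypothesis P_ge0 : forall e f, 0 <= P e f.

(** The total weight of the walks with [n] steps from [e]: the [n]-th power of [P] applied to the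
    all-ones vector. *)
Fixpoint walk_weight (n : nat) (e : E) : R :=
  if n is n'.+1 then \sum_f P e f * walk_weight n' f else 1.

Definition cumulative_weight (n : nat) (e : E) : R :=
  \sum_(k < n.+1) walk_weight k e.

Lemma walk_weight_ge0 n e : 0 <= walk_weight n e.
Proof.
by elim: n e => //= n IH e; apply: sumr_ge0 => f _; rewrite mulr_ge0.
Qed.

(** Walks are split at their first step, and the 1 is the empty walk. The norms of the truncated
    functions satisfy the same recursion. *)
Lemma cumulative_weightS n e :
  cumulative_weight n.+1 e = 1 + \sum_f P e f * cumulative_weight n f.
Proof.
rewrite /cumulative_weight big_ord_recl; congr (_ + _).
rewrite [RHS](_ : _ = \sum_f \sum_(k < n.+1) P e f * walk_weight k f).
  by rewrite exchange_big.
by apply: eq_bigr => f _; rewrite mulr_sumr.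
Qed.

Definition walk_matrix : 'M[R[i]]_#|E| :=
  \matrix_(i, j) (P (enum_val i) (enum_val j))%:C%C.

Lemma walk_matrixX n i :
  (walk_matrix ^+ n *m const_mx 1 : 'cV[R[i]]_#|E|) i 0 =
  (walk_weight n (enum_val i))%:C%C.
Proof.
elim: n i => [|n IH] i; first by rewrite mul1mx mxE.
rewrite exprS -mulmxA mxE /= rmorph_sum /=.
rewrite [RHS](reindex_onto (@enum_val _ E) enum_rank) /=; last first.
  by move=> f _; rewrite enum_rankK.
apply: eq_big => [j|j _]; first by rewrite enum_valK eqxx.
by rewrite IH mxE rmorphM.
Qed.

Lemma walk_weight_growth q : spectral_radius walk_matrix = 1 -> 1 < q ->
  exists2 K : R, 0 <= K & forall n e, walk_weight n e <= K * q ^+ n.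
Proof.
move=> rho1 q1.
have [|eig_le1 _] := @spectral_radius_attained _ _ walk_matrix.
  by rewrite rho1.
rewrite rho1 in eig_le1.
have [K K0 KP] := power_growth (const_mx 1) q1 eig_le1.
exists K => // n e.
rewrite -(enum_rankK e) -[leLHS]normc_real ?walk_weight_ge0//.
by rewrite -walk_matrixX KP.
Qed.

(** With [w] the modulus of an eigenvector whose eigenvalue has modulus 1, [w <= w P]. Pairing this
    with the nonnegative [walk_weight n] shows that the weighted sum does not decrease from [n] to
    [n + 1]. *)
Lemma walk_weight_mean_ge : spectral_radius walk_matrix = 1 ->
  exists w : E -> R, [/\ forall e, 0 <= w e, 0 < \sum_e w e &
    forall n, \sum_e w e <= \sum_e w e * walk_weight n e].
Proof.
move=> rho1.
have [|_ [z zA z1]] := @spectral_radius_attained _ _ walk_matrix.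
  by rewrite rho1.
have [|w [w0 ws ww]] := eigenvector_modulus zA; first by rewrite z1 rho1.
have sumE (F : 'I_#|E| -> R) : \sum_i F i = \sum_e F (enum_rank e).
  rewrite (reindex_onto (@enum_rank E) enum_val) /=; last first.
    by move=> i _; rewrite enum_valK.
  by apply: eq_bigl => e; rewrite enum_rankK eqxx.
exists (fun e => w (enum_rank e)); split=> [//||n]; first by rewrite -sumE.
elim: n => [|n IH].
  by rewrite le_eqVlt; apply/orP; left; apply/eqP/eq_bigr => e _; rewrite mulr1.
apply: le_trans IH _.
rewrite [leRHS](_ : _ =
    \sum_f (\sum_e w (enum_rank e) * P e f) * walk_weight n f); last first.
  under eq_bigr do rewrite mulr_sumr.
  rewrite exchange_big /=; apply: eq_bigr => f _.
  by rewrite mulr_suml; apply: eq_bigr => e _; rewrite mulrA.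
apply: ler_sum => f _; rewrite ler_wpM2r ?walk_weight_ge0//.
apply: (le_trans (ww _)); rewrite sumE le_eqVlt; apply/orP; left; apply/eqP.
by apply: eq_bigr => e _; rewrite mxE !enum_rankK normc_real.
Qed.

(* The bound forces geometric growth of the partial sums once they exceed D,
   contradicting subexponential growth; so they are bounded by D, contradicting
   the lower bound on a weighted mean. *)
Lemma cumulative_weight_not_bounded_by_last (D : R) :
  spectral_radius walk_matrix = 1 ->
  ~ forall n e, cumulative_weight n e <= D * (1 + walk_weight n e).
Proof.
move=> rho1 bound.
wlog D1 : D bound / 1 <= D.
  move=> wl; apply: (wl (Num.max D 1)); last by rewrite le_max lexx orbT.
  move=> n e; apply: (le_trans (bound n e)).
  by rewrite ler_wpM2r ?addr_ge0 ?walk_weight_ge0// le_max lexx.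
have D0 : 0 < D by lra.
have cumulative_weightE n e :
    cumulative_weight n.+1 e = cumulative_weight n e + walk_weight n.+1 e.
  by rewrite /cumulative_weight big_ord_recr.
have leD n e : cumulative_weight n e <= D.
  rewrite leNgt; apply/negP => gtD.
  (* This choice gives [q ^+ 2 <= 1 + D^-1]: the excess over [D] gains a factor of at least [q ^+ 2]
     per step, while the weights grow at most at rate [q]. *)
  pose q : R := 1 + (3 * D)^-1.
  have D3 : 0 < (3 * D)^-1 by rewrite invr_gt0; lra.
  have q1 : 1 < q by rewrite /q; lra.
  have qq : q ^+ 2 <= 1 + D^-1.
    have -> : D^-1 = 3 * (3 * D)^-1 by field; rewrite gt_eqF.
    have D31 : (3 * D)^-1 <= 1 by rewrite invf_le1; lra.
    by rewrite /q; nra.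
  have [K K0 KP] := walk_weight_growth rho1 q1.
  set d := cumulative_weight n e - D.
  have d0 : 0 < d by rewrite subr_gt0.
  have grow k : (q ^+ 2) ^+ k * d <= cumulative_weight (n + k) e - D.
    elim: k => [|k IH]; first by rewrite addn0 mul1r.
    have X0 : 0 < cumulative_weight (n + k) e - D.
      by apply: lt_le_trans IH; rewrite mulr_gt0// exprn_gt0// exprn_gt0//; lra.
    apply: (@le_trans _ _ ((1 + D^-1) * (cumulative_weight (n + k) e - D))).
      rewrite exprS -mulrA ler_pM ?mulr_ge0 ?exprn_ge0//; lra.
    have := bound (n + k).+1 e; rewrite addnS cumulative_weightE.
    set X := cumulative_weight _ _; set a := walk_weight _ _ => bnd.
    have a0 : 0 <= a by exact: walk_weight_ge0.
    (* The hypothesis reads [X + a <= D + D * a], so the new weight [a] is at least a fixed fraction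
       of the excess. *)
    have XD : (X - D) / D <= a by rewrite ler_pdivrMr//; lra.
    by rewrite mulrDl mul1r [D^-1 * _]mulrC; lra.
  (* Comparing [q ^+ (2 * k)] from below with [q ^+ (n + k)] from above and cancelling [q ^+ k]
     leaves a right-hand side free of [k]. *)
  have expo k : q ^+ k * d <= D * (1 + K) * q ^+ n.
    have qk0 m : 0 < q ^+ m by rewrite exprn_gt0//; lra.
    have qk1 m : 1 <= q ^+ m by rewrite exprn_ege1// ltW.
    rewrite -(ler_pM2l (qk0 k)) mulrA -expr2 -exprM mulnC exprM.
    apply: (le_trans (grow k)); rewrite lerBlDr.
    apply: (le_trans (bound _ _)).
    have := KP (n + k)%N e; rewrite exprD => h.
    apply: (@le_trans _ _ (D * (1 + K * (q ^+ n * q ^+ k)))).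
      by rewrite ler_pM2l// lerD2l.
    have x1 : 1 <= q ^+ n * q ^+ k by rewrite -exprD.
    rewrite [q ^+ k * (_ * _)]mulrC -[D * _ * _ * _]mulrA.
    move: (q ^+ n * q ^+ k) x1 => x x1.
    have : 0 <= D * (x - 1) by rewrite mulr_ge0 ?subr_ge0// ltW.
    by lra.
  have [k kP] : exists k : nat, D * (1 + K) * q ^+ n / d / (q - 1) < k%:R.
    exists (Num.truncn (D * (1 + K) * q ^+ n / d / (q - 1))).+1.
    by rewrite truncnS_gt.
  have := expo k; apply/negP; rewrite -ltNge.
  rewrite ltr_pdivrMr ?subr_gt0// ltr_pdivrMr// in kP.
  apply: (lt_le_trans kP); rewrite ler_pM2r//.
  (* Bernoulli's inequality, which makes [q ^+ k] unbounded. *)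
  have : 1 + k%:R * (q - 1) <= q ^+ k.
    elim: (k) => [|m IH]; first by rewrite mul0r addr0.
    have : 0 <= (q - 1) * (q ^+ m - 1).
      by rewrite mulr_ge0 ?subr_ge0 ?exprn_ege1// ltW.
    by rewrite exprS -natr1; lra.
  by lra.
have [w [w0 ws ww]] := walk_weight_mean_ge rho1.
(* Each of the [n + 1] weights has [w]-weighted sum at least [\sum_e w e]. Taking [n = Num.truncn D]
   then contradicts [D < n + 1]. *)
have wD n : n.+1%:R * \sum_e w e <= D * \sum_e w e.
  apply: (@le_trans _ _ (\sum_e w e * cumulative_weight n e)).
    rewrite /cumulative_weight; under [leRHS]eq_bigr do rewrite mulr_sumr.
    rewrite exchange_big /=.
    apply: (@le_trans _ _ (\sum_(k < n.+1) \sum_e w e)); last exact: ler_sum.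
    by rewrite sumr_const card_ord mulr_natl.
  rewrite mulr_sumr; apply: ler_sum => e _.
  by rewrite [D * _]mulrC ler_wpM2l.
have := wD (Num.truncn D); rewrite ler_pM2r//.
by rewrite leNgt truncnS_gt.
Qed.

End WeightedWalks.

(** * Squared norms in [ell2] *)

Section Ell2Norms.
Variables (R : realType) (V : choiceType).
Implicit Types (f g : ell2 R V) (x y : V).

Lemma ell2_addE f g x : (f + g) x = f x + g x.
Proof. by []. Qed.

Lemma ell2_scaleE (a : R[i]) f x : (a *: f) x = a * f x.
Proof. by []. Qed.

Lemma ell2_sumE (I : Type) (s : seq I) (Q : pred I) (F : I -> ell2 R V) x :
  (\sum_(i <- s | Q i) F i) x = \sum_(i <- s | Q i) F i x.
Proof. by elim/big_rec2: _ => // i _ g _ <-. Qed.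

Lemma ell2P f g : (forall x, f x = g x) -> f = g.
Proof. by move=> fg; apply/val_inj/funext. Qed.

(** The partial sums over finite sets containing [x] all equal [g x], so the net is eventually
    constant. *)
Lemma ell2_inner_delta x g : ell2_inner (ell2_delta R x) g = g x.
Proof.
rewrite /ell2_inner /summability.sum.
have FF : ProperFilter (@summability.totally V).
  exact: summability.totally_filter.
apply: (@lim_near_cst (R[i]^o : normedModType R[i])) => //.
exists (fset1 x) => // A /= xA.
have xinA : x \in A by apply: (fsubsetP xA); rewrite in_fset1.
rewrite /summability.partial_sum (bigD1 (FSetSub xinA))//= big1 => [|i ix].
  by rewrite eqxx conjc1 mul1r addr0.
have : fsval i != x by apply: contra ix => /eqP ix; apply/eqP/val_inj.
by move/negPf => ->; rewrite conjc0 mul0r.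
Qed.

Definition ell2_sqnorm f : R :=
  fine (\esum_(x in [set: V]) ((normc (f x)) ^+ 2)%:E)%E.

Lemma ell2_sqnormE f :
  (ell2_sqnorm f)%:E = (\esum_(x in [set: V]) ((normc (f x)) ^+ 2)%:E)%E.
Proof.
rewrite fineK// ge0_fin_numE; last first.
  by apply: esum_ge0 => x _; rewrite lee_fin sqr_ge0.
by have := ell2_funP f; rewrite inE.
Qed.

Lemma ell2_sqnorm_ge0 f : 0 <= ell2_sqnorm f.
Proof. by apply/fine_ge0/esum_ge0 => x _; rewrite lee_fin sqr_ge0. Qed.

Lemma ell2_norm_sqr f : ell2_norm f ^+ 2 = ell2_sqnorm f.
Proof. by rewrite sqr_sqrtr// ell2_sqnorm_ge0. Qed.

Lemma ell2_sqnorm0 : ell2_sqnorm 0 = 0.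
Proof.
rewrite /ell2_sqnorm esum1// => x _.
by rewrite (_ : (0 : ell2 R V) x = 0)// normc0 expr0n.
Qed.

Lemma ell2_sqnorm_delta x : ell2_sqnorm (ell2_delta R x) = 1.
Proof.
apply: EFin_inj; rewrite ell2_sqnormE /=.
rewrite (_ : (fun y => _) = (fun y => if y \in [set x] then 1%E else 0%E)).
  by rewrite -(esum_mkcond [set x] (fun=> 1%E)) esum_set1.
apply/funext => y; have [->|/eqP yx] := eqVneq y x.
  by rewrite mem_set// normc1 expr1n.
by rewrite memNset// normc0 expr0n.
Qed.

(** One inequality holds for every scalar; the reverse one is its instance at [a^-1] and
    [a *: f]. *)
Lemma ell2_sqnormZ (a : R[i]) f :
  ell2_sqnorm (a *: f) = normc a ^+ 2 * ell2_sqnorm f.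
Proof.
have le b g : ell2_sqnorm (b *: g) <= normc b ^+ 2 * ell2_sqnorm g.
  rewrite -lee_fin EFinM !ell2_sqnormE.
  apply: ge_ereal_sup => _ [X [finX _]] <-.
  under eq_fsbigr do rewrite ell2_scaleE normcM exprMn EFinM.
  rewrite -ge0_mule_fsumr; last by move=> x; rewrite lee_fin sqr_ge0.
  by apply: lee_wpmul2l; rewrite ?lee_fin ?sqr_ge0//; apply: esum_ge; exists X.
have [->|a0] := eqVneq a 0.
  by rewrite scale0r ell2_sqnorm0 normc0 expr0n mul0r.
apply/le_anti; rewrite le /=.
have a2 : 0 < normc a ^+ 2.
  rewrite exprn_gt0// lt_neqAle normc_ge0 eq_sym andbT.
  by apply: contra a0 => /eqP/eq0_normc ->.
have := le a^-1 (a *: f).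
by rewrite scalerA mulVf// scale1r normcV exprVn mulrC ler_pdivlMr// mulrC.
Qed.

Lemma ell2_sqnormD f g : (forall x, f x = 0 \/ g x = 0) ->
  ell2_sqnorm (f + g) = ell2_sqnorm f + ell2_sqnorm g.
Proof.
move=> fg; apply: EFin_inj; rewrite EFinD !ell2_sqnormE -esumD; last 2 first.
- by move=> x _; rewrite lee_fin sqr_ge0.
- by move=> x _; rewrite lee_fin sqr_ge0.
apply: eq_esum => x _; rewrite ell2_addE -EFinD.
by case: (fg x) => ->; rewrite normc0 expr0n ?(add0r, addr0).
Qed.

Lemma ell2_sqnormD_le f g :
  ell2_sqnorm (f + g) <= 2 * (ell2_sqnorm f + ell2_sqnorm g).
Proof.
have -> : 2 * (ell2_sqnorm f + ell2_sqnorm g) =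
    ell2_sqnorm f + ell2_sqnorm f + (ell2_sqnorm g + ell2_sqnorm g) by ring.
rewrite -lee_fin !EFinD !ell2_sqnormE.
rewrite -!esumD; do ?by move=> x _; rewrite ?adde_ge0// lee_fin sqr_ge0.
apply: le_esum => x _; rewrite -!EFinD lee_fin ell2_addE.
have := normc_triangle (f x) (g x).
move: (normc_ge0 (f x)) (normc_ge0 (g x)) (normc_ge0 (f x + g x)).
move: (normc (f x)) (normc (g x)) (normc (f x + g x)) => a b c a0 b0 c0 cab.
apply: (@le_trans _ _ ((a + b) ^+ 2)).
  by rewrite ler_sqr ?nnegrE ?addr_ge0.
have := sqr_ge0 (a - b); rewrite !expr2; lra.
Qed.

Lemma ell2_sqnorm_sum (I : eqType) (s : seq I) (F : I -> ell2 R V) : uniq s ->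
  {in s &, forall i j, i != j -> forall x, F i x = 0 \/ F j x = 0} ->
  ell2_sqnorm (\sum_(i <- s) F i) = \sum_(i <- s) ell2_sqnorm (F i).
Proof.
elim: s => [|i s IH] /=; first by rewrite !big_nil ell2_sqnorm0.
move=> /andP[ins us] dis; rewrite !big_cons ell2_sqnormD ?IH//.
  by move=> j k js ks; apply: dis; rewrite inE ?js ?ks orbT.
move=> x; have [->|/eqP Fi] := eqVneq (F i x) 0; [by left|right].
rewrite ell2_sumE big_seq big1// => j js.
have ij : i != j by apply: contraNneq ins => ->.
have j_is : j \in i :: s by rewrite inE js orbT.
by case: (dis i j (mem_head i s) j_is ij x).
Qed.

End Ell2Norms.

(** * Cones in an acyclic graph *)

Section Cones.
Variables (V : choiceType) (G : sgraph V).

(** In a tree with [x] adjacent to [y], this is the component of [y] after deletion of [x].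
    Arbitrary walks are allowed, so that they can be concatenated freely. *)
Definition cone (x y : V) : set V :=
  [set v | exists p, [/\ path G y p, last y p = v & x \notin y :: p]].

Lemma cone_apex x y : x != y -> cone x y y.
Proof. by move=> xy; exists [::]; rewrite /= inE. Qed.

Lemma cone_avoids x y : ~ cone x y x.
Proof. by case=> p [_ yx]; rewrite -{1}yx mem_last. Qed.

Hypothesis acyclicG : acyclic_graph G.

(** A walk avoiding [y] shortens to a simple path; closed up through [y] it is a cycle, of length at
    least 3 unless [z = z']. *)
Lemma neighbours_not_joined y z z' p : G y z -> G y z' ->
  path G z p -> last z p = z' -> y \notin z :: p -> z = z'.
Proof.
move=> yz yz' zp zz'; rewrite -{}zz' in yz' *.
case/shortenP: zp yz' => p' zp' up' sub yz'' yp.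
have yp' : y \notin z :: p'.
  apply: contra yp; rewrite !inE => /orP[->//|/sub->]; exact: orbT.
have : (size (y :: z :: p') < 3)%N.
  apply: acyclicG; last by rewrite cons_uniq yp'.
  by rewrite /= yz rcons_path zp' /= adj_sym.
by case: p' {zp' up' sub yp' yz''} => //=.
Qed.

(** Prefix the walk with [y]. If it met [x], then [z] and [x] would be distinct neighbours of [y]
    joined by a walk avoiding [y]. *)
Lemma cone_sub x y z : G x y -> G y z -> z != x -> cone y z `<=` cone x y.
Proof.
move=> xy yz zx v [p [zp zv yp]]; exists (z :: p).
split=> //=; first by rewrite yz.
rewrite inE negb_or; apply/andP; split.
  by apply: contraTneq xy => ->; rewrite adj_irr.
apply/negP => xp; move: zx; apply/negP; rewrite negbK; apply/eqP.
have [p' [zp' lp' sub]] : exists p', [/\ path G z p', last z p' = x &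
    {subset z :: p' <= z :: p}].
  move: xp; rewrite inE => /predU1P[->|xp].
    by exists [::]; split=> // t; rewrite !inE => ->.
  case/path.splitP: xp zp {zv yp} => p1 p2; rewrite cat_path => /andP[zp1 _].
  exists (rcons p1 x); split=> //; first by rewrite last_rcons.
  by move=> t; rewrite !inE mem_cat => /orP[->|->]; rewrite ?orbT.
apply: (neighbours_not_joined yz _ zp' lp'); first by rewrite adj_sym.
by apply: contra yp => /sub.
Qed.

(** Following one walk to [v] and the other one back joins [z] to [z'] while avoiding [y]. *)
Lemma cone_disjoint y z z' v : G y z -> G y z' ->
  cone y z v -> cone y z' v -> z = z'.
Proof.
move=> yz yz' [p [zp zv yp]] [p' [zp' zv' yp']].
apply: (@neighbours_not_joined y z z' (p ++ rev (belast z' p'))) => //.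
- rewrite cat_path zp zv -zv' rev_path /=.
  by rewrite (eq_path (e' := G)) // => a b; rewrite adj_sym.
- rewrite last_cat zv -zv'; case: (p') => //= a s.
  by rewrite rev_cons last_rcons.
rewrite -cat_cons mem_cat negb_or yp mem_rev /=.
by apply: contra yp'; exact: mem_belast.
Qed.

(** Connectedness excludes the default value 0 of [gdist]. *)
Lemma gdist_gt1 x y : connected_graph G -> x != y -> ~~ G x y ->
  (1 < gdist G x y)%N.
Proof.
move=> [_ connG] xy nxy; rewrite /gdist; case: pselect => [h|[]]; last first.
  by have [p [xp py]] := connG x y; exists (size p); apply/asboolP; exists p.
case: ex_minnP => -[|[|//]] /asboolP[p [xp py sp]] _.
  by move: py xy; rewrite (size0nil sp) /= => ->; rewrite eqxx.
case: p sp xp py => [//|a [|//]] _ /= /[swap] -> .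
by rewrite (negPf nxy).
Qed.

End Cones.

(** * Lifting directed edges to the universal cover *)

Section Covers.
Variables (V : choiceType) (W : finType) (T : sgraph V) (H : sgraph W).
Variable pi : V -> W.
Hypothesis cover : universal_cover T H pi.

(** The neighbour is unique by the covering property; the default [y] arises only if [b] is not
    adjacent to [pi y]. *)
Definition lift_neighbour (y : V) (b : W) : V :=
  xget y [set z | T y z /\ pi z = b].

Lemma lift_neighbourP y b : H (pi y) b ->
  T y (lift_neighbour y b) /\ pi (lift_neighbour y b) = b.
Proof.
move=> yb; rewrite /lift_neighbour; case: xgetP => [z _ //|no].
case: cover => _ _ /(_ y)[_ _ /(_ b yb)[z yz zb]].
by case: (no z).
Qed.

Lemma cover_inj y z z' : T y z -> T y z' -> pi z = pi z' -> z = z'.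
Proof.
move=> yz yz'; case: cover => _ _ /(_ y)[_ inj _].
by apply: inj; rewrite inE.
Qed.

(** A walk in [H] lifts step by step, starting from some vertex of [T]. *)
Lemma cover_surj : connected_graph H -> forall a, exists x, pi x = a.
Proof.
move=> [_ connH] a; case: cover => -[[[x0 _] _] _] _ _.
have [p [xp <-]] := connH (pi x0) a.
elim: p x0 xp => [|b p IH] x0 /=; first by exists x0.
move=> /andP[/lift_neighbourP[_ <-]]; exact: IH.
Qed.

Definition lies_over (e : dedge H) (x y : V) :=
  [/\ T x y, pi x = etail e & pi y = ehead e].

Lemma lies_over_surj : connected_graph H ->
  forall e, exists x y, lies_over e x y.
Proof.
move=> connH e; have [x xe] := cover_surj connH (etail e).
have He : H (pi x) (ehead e) by rewrite xe; exact: (valP e).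
by have [xy ye] := lift_neighbourP He; exists x, (lift_neighbour x (ehead e)).
Qed.

Lemma dedge_eq (e f : dedge H) : etail e = etail f -> ehead e = ehead f -> e = f.
Proof.
case: e f => [[a b] ab] [[c d] cd]; rewrite /etail /ehead /= => ac bd.
by apply: val_inj; rewrite /= ac bd.
Qed.

(** Non-backtracking lifts: if the lift of [f] returned to [x], then [f] would be [erev e]. *)
Lemma lies_over_step e f x y : lies_over e x y -> follows e f ->
  lies_over f y (lift_neighbour y (ehead f)) /\ lift_neighbour y (ehead f) != x.
Proof.
move=> [xy xe ye] /andP[/eqP ef fe].
have yf : H (pi y) (ehead f) by rewrite ye ef; exact: (valP f).
have [yz zf] := lift_neighbourP yf; split; first by split; rewrite // ye.
apply: contra fe => /eqP zx; apply/eqP/dedge_eq; first by rewrite -ef.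
by rewrite -zf zx xe.
Qed.

Lemma lift_neighbour_inj e f f' x y : lies_over e x y ->
  follows e f -> follows e f' ->
  lift_neighbour y (ehead f) = lift_neighbour y (ehead f') -> f = f'.
Proof.
move=> exy ef ef' ff'.
have [[_ ytf zhf] _] := lies_over_step exy ef.
have [[_ ytf' zhf'] _] := lies_over_step exy ef'.
by apply: dedge_eq; rewrite -?ytf ?ytf' // -zhf ff' zhf'.
Qed.

(** Together with [lies_over_step] and [lift_neighbour_inj], this matches the neighbours of [y]
    other than [x] with the edges following [e]. *)
Lemma neighbour_follows e x y z : lies_over e x y -> T y z -> z != x ->
  exists2 f, follows e f & lift_neighbour y (ehead f) = z.
Proof.
move=> [xy xe ye] yz zx.
have yz' : H (pi y) (pi z) by case: cover => _ hom _; exact: hom.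
have [yl lz] := lift_neighbourP yz'.
exists (exist _ (pi y, pi z) yz' : dedge H); last exact: cover_inj yl yz lz.
rewrite /follows /etail /= -ye eqxx /=; apply: contra zx => /eqP[_ zt].
by apply/eqP/(cover_inj yz); rewrite ?xe// adj_sym.
Qed.

End Covers.

(** * The operator on functions truncated to a cone *)

Section Operator.
Variables (R : realType) (V : choiceType) (W : finType).
Variables (T : sgraph V) (H : sgraph W) (pi : V -> W).
Variable M : {linear ell2 R V -> ell2 R V}.
Hypothesis cover : universal_cover T H pi.
Hypothesis localM : local_op T M.
Hypothesis pulledM : pulled_back T pi M.
Variable r : dedge H -> R[i].
Hypothesis ratio_r : finite_ratio_system (base_entry T pi M) r.

Let m : W -> W -> R[i] := base_entry T pi M.
Let delta : V -> ell2 R V := @ell2_delta R V.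
Let lift := lift_neighbour T pi.

Let acyclicT : acyclic_graph T.
Proof. by case: cover => -[]. Qed.

Lemma entryE x y : entry M x y = M (delta y) x.
Proof. exact: ell2_inner_delta. Qed.

Lemma deltaE x w : delta x w = (w == x)%:R.
Proof. by []. Qed.

Lemma base_entryE x y : x = y \/ T x y -> m (pi x) (pi y) = entry M x y.
Proof.
move=> xy; rewrite /m /base_entry.
case: xgetP => [z _ [x' [y' [xy' xx' yy' ->]]]|no].
  exact: pulledM.
by case: (no (entry M x y)); exists x, y.
Qed.

Lemma entry_far x y : x != y -> ~~ T x y -> entry M x y = 0.
Proof.
by move=> xy nxy; apply/localM/gdist_gt1 => //; case: cover => -[].
Qed.

(** The column of [M] at [y] is read off at [y], at its parent [x] and at its children; locality
    kills the rest. The row index of a child's entry is the child, hence [erev f]. *)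
Lemma operator_delta e x y : lies_over T pi e x y ->
  M (delta y) = m (ehead e) (ehead e) *: delta y + edge_val m e *: delta x +
    \sum_(f : dedge H | follows e f)
      edge_val m (erev f) *: delta (lift y (ehead f)).
Proof.
move=> exy; have [xy xe ye] := exy; apply: ell2P => w.
have yx : T y x by rewrite adj_sym.
have nyx : y != x by apply: contraTneq xy => ->; rewrite adj_irr.
rewrite -entryE !ell2_addE ell2_sumE !ell2_scaleE !deltaE.
have sum0 : (w = y \/ w = x \/ ~~ T y w) -> \sum_(f : dedge H | follows e f)
    (edge_val m (erev f) *: delta (lift y (ehead f))) w = 0.
  move=> ww; apply: big1 => f ef; rewrite ell2_scaleE deltaE.
  have [wl|] := eqVneq w _; last by rewrite mulr0.
  have [[yw _ _] wx] := lies_over_step cover exy ef.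
  rewrite -/lift -wl in yw wx; exfalso.
  case: ww => [wy|[wx'|nyw]]; first by rewrite wy adj_irr in yw.
    by rewrite wx' eqxx in wx.
  by rewrite yw in nyw.
have [wy|wy] := eqVneq w y.
  rewrite sum0; last by left.
  by rewrite wy (negPf nyx) mulr0 !addr0 mulr1 -ye base_entryE//; left.
have [wx|wx] := eqVneq w x.
  rewrite sum0; last by right; left.
  by rewrite mulr0 add0r addr0 mulr1 wx /edge_val -ye -xe base_entryE//; right.
rewrite !mulr0 !add0r.
have [yw|nyw] := boolP (T y w); last first.
  rewrite sum0; last by right; right.
  by rewrite entry_far// adj_sym.
have [f0 ef0 lf0] := neighbour_follows cover exy yw wx.
rewrite (bigD1 f0)// big1 => [|f /andP[ef ff0]]; last first.
  rewrite ell2_scaleE deltaE.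
  have [wl|_] := eqVneq w (lift y (ehead f)); last by rewrite mulr0.
  case/eqP: ff0; apply: (lift_neighbour_inj cover exy ef ef0).
  by rewrite lf0 wl.
rewrite Monoid.mulm1 ell2_scaleE deltaE /lift lf0 eqxx mulr1.
have [[_ yf0 wf0] _] := lies_over_step cover exy ef0.
rewrite lf0 in wf0.
rewrite /edge_val /erev /etail /ehead /= -/(etail f0) -/(ehead f0) -wf0 -yf0.
by rewrite base_entryE// adj_sym; right.
Qed.

(* [cone_fun n e y] is the product of the ratios along the path from y, on the
   vertices of the cone at distance at most n from y. *)
Fixpoint cone_fun (n : nat) (e : dedge H) (y : V) : ell2 R V :=
  if n is n'.+1 then
    delta y + \sum_(f : dedge H | follows e f)
      r f *: cone_fun n' f (lift y (ehead f))
  else delta y.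

(** The defect of a cut at [y]. By the ratio equation the first coefficient is minus what the
    missing children would contribute at [y]; the sum is what [delta y] sends to them. *)
Definition apex_err (e : dedge H) (y : V) : ell2 R V :=
  (m (ehead e) (ehead e) + edge_val m (erev e) / r e) *: delta y +
  \sum_(f : dedge H | follows e f)
    edge_val m (erev f) *: delta (lift y (ehead f)).

(** The defects at the vertices of layer [n], each scaled by the product of ratios along its path;
    it lives in layers [n] and [n + 1]. *)
Fixpoint cone_err (n : nat) (e : dedge H) (y : V) : ell2 R V :=
  if n is n'.+1 then
    \sum_(f : dedge H | follows e f) r f *: cone_err n' f (lift y (ehead f))
  else apex_err e y.

(* The ratio equation cancels every interior coefficient. *)
Lemma operator_cone_fun n e x y : lies_over T pi e x y ->
  M (cone_fun n e y) =
  edge_val m e *: delta x - (edge_val m (erev e) / r e) *: delta y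
  + cone_err n e y.
Proof.
elim: n e x y => [|n IH] e x y exy /=.
  rewrite (operator_delta exy) /apex_err scalerDl addrA [in RHS]addrA.
  congr (_ + _); rewrite -addrA [_ + (edge_val _ _ / _) *: _]addrC.
  by rewrite addrA addrNK addrC.
rewrite linearD linear_sum /= (operator_delta exy).
rewrite -addrA -big_split /=.
have -> : \sum_(f : dedge H | follows e f)
     (edge_val m (erev f) *: delta (lift y (ehead f)) +
      M (r f *: cone_fun n f (lift y (ehead f)))) =
    \sum_(f : dedge H | follows e f) ((edge_val m f * r f) *: delta y +
      r f *: cone_err n f (lift y (ehead f))).
  apply: eq_bigr => f ef; rewrite linearZ /=.
  have [fyz _] := lies_over_step cover exy ef.
  (* The factor [r f] clears the denominator at the child, whose coefficient then cancels the value
     sent there by [delta y]; [edge_val m f * r f] returns to [y]. *)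
  rewrite (IH _ _ _ fyz) 2!scalerDr scalerN !scalerA.
  have rf0 : r f != 0 by case: ratio_r.
  by rewrite mulrCA divff// mulr1 [r f * _]mulrC addrA addrCA subrr addr0.
rewrite big_split /= -scaler_suml addrA; congr (_ + _).
rewrite [_ *: _ + _ *: delta x]addrC -addrA -scalerDl -scaleNr.
(* What is left is the coefficient of [delta y], given by the ratio equation at [e]. *)
congr (_ + _ *: _); case: ratio_r => _ /(_ e); rewrite -/m.
by move/eqP; rewrite eq_sym addrAC addr_eq0 => /eqP.
Qed.

(** * Squared norms of the truncated functions and of their errors *)

Definition ratio_weight (e f : dedge H) : R :=
  if follows e f then normc (r f) ^+ 2 else 0.

Lemma ratio_weight_ge0 e f : 0 <= ratio_weight e f.
Proof. by rewrite /ratio_weight; case: ifP => // _; rewrite sqr_ge0. Qed.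

Lemma ratio_matrixE : ratio_matrix r = walk_matrix ratio_weight.
Proof.
apply/matrixP => i j; rewrite !mxE /ratio_weight; case: ifP => // _.
by rewrite rmorphXn.
Qed.

Definition supported (A : set V) (g : ell2 R V) := forall v, ~ A v -> g v = 0.

Lemma supported_delta A y : A y -> supported A (delta y).
Proof.
move=> Ay v nAv; rewrite /= (_ : v == y = false)//.
by apply/eqP => vy; rewrite vy in nAv.
Qed.

Lemma supported_scale A a g : supported A g -> supported A (a *: g).
Proof. by move=> Ag v /Ag vA; rewrite ell2_scaleE vA mulr0. Qed.

Section Branches.
Variables (e : dedge H) (x y : V) (exy : lies_over T pi e x y).
Variables (c : dedge H -> R[i]) (g : dedge H -> ell2 R V).
Hypothesis g_supp : forall f, follows e f ->
  supported (cone T y (lift y (ehead f))) (g f).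

Lemma branches_supported :
  supported (cone T x y) (\sum_(f : dedge H | follows e f) c f *: g f).
Proof.
move=> v nv; rewrite ell2_sumE big1// => f ef; rewrite ell2_scaleE g_supp ?mulr0//.
apply: contra_not nv; have [[yz _ _] zx] := lies_over_step cover exy ef.
by apply: cone_sub => //; case: exy.
Qed.

Lemma branches_apex : (\sum_(f : dedge H | follows e f) c f *: g f) y = 0.
Proof.
rewrite ell2_sumE big1// => f ef; rewrite ell2_scaleE g_supp ?mulr0//.
exact: cone_avoids.
Qed.

(** Distinct edges following [e] lead into disjoint cones, so the squared norms add. *)
Lemma branches_sqnorm :
  ell2_sqnorm (\sum_(f : dedge H | follows e f) c f *: g f) =
  \sum_(f : dedge H | follows e f) normc (c f) ^+ 2 * ell2_sqnorm (g f).
Proof.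
rewrite -big_filter ell2_sqnorm_sum ?filter_uniq ?index_enum_uniq//; last first.
  move=> f f'; rewrite !mem_filter => /andP[ef _] /andP[ef' _] ff' v.
  have [[yz _ _] _] := lies_over_step cover exy ef.
  have [[yz' _ _] _] := lies_over_step cover exy ef'.
  have [Cv|nCv] := pselect (cone T y (lift y (ehead f)) v); last first.
    by left; rewrite ell2_scaleE g_supp ?mulr0.
  right; rewrite ell2_scaleE g_supp ?mulr0// => Cv'.
  by move/eqP: ff'; apply; apply: (lift_neighbour_inj cover exy) => //;
     apply: (cone_disjoint acyclicT yz yz' Cv Cv').
by rewrite big_filter; apply: eq_bigr => f _; rewrite ell2_sqnormZ.
Qed.

End Branches.

Lemma delta_supported (e : dedge H) x y : lies_over T pi e x y ->
  supported (cone T x y) (delta y).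
Proof.
move=> [xy _ _]; apply/supported_delta/cone_apex.
by apply: contraTneq xy => ->; rewrite adj_irr.
Qed.

Lemma delta_lift_supported (e : dedge H) x y f :
  lies_over T pi e x y -> follows e f ->
  supported (cone T y (lift y (ehead f))) (delta (lift y (ehead f))).
Proof. by move=> exy /(lies_over_step cover exy)[/delta_supported]. Qed.

Lemma add_supported A (g h : ell2 R V) :
  supported A g -> supported A h -> supported A (g + h).
Proof. by move=> Ag Ah v nAv; rewrite ell2_addE Ag// Ah// addr0. Qed.

Lemma cone_fun_supported n e x y : lies_over T pi e x y ->
  supported (cone T x y) (cone_fun n e y).
Proof.
elim: n e x y => [|n IH] e x y exy /=; first exact: delta_supported exy.
apply: add_supported; first exact: delta_supported exy.
apply: branches_supported => // f ef.
by have [fyz _] := lies_over_step cover exy ef; exact: IH fyz.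
Qed.

Lemma cone_err_supported n e x y : lies_over T pi e x y ->
  supported (cone T x y) (cone_err n e y).
Proof.
elim: n e x y => [|n IH] e x y exy /=.
  apply: add_supported; first exact/supported_scale/delta_supported/exy.
  by apply: branches_supported => // f ef; exact: delta_lift_supported exy ef.
apply: branches_supported => // f ef.
by have [fyz _] := lies_over_step cover exy ef; exact: IH fyz.
Qed.

Lemma sum_ratio_weight e (F : dedge H -> R) :
  \sum_(f : dedge H | follows e f) normc (r f) ^+ 2 * F f =
  \sum_f ratio_weight e f * F f.
Proof.
rewrite big_mkcond; apply: eq_bigr => f _.
by rewrite /ratio_weight; case: ifP => // _; rewrite mul0r.
Qed.

(** The apex contributes 1 and each branch its own squared norm times [ratio_weight], all on
    disjoint supports: the recursion of [cumulative_weightS]. *)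
Lemma cone_fun_sqnorm n e x y : lies_over T pi e x y ->
  ell2_sqnorm (cone_fun n e y) = cumulative_weight ratio_weight n e.
Proof.
elim: n e x y => [|n IH] e x y exy /=.
  by rewrite ell2_sqnorm_delta /cumulative_weight big_ord1.
have supp f : follows e f ->
    supported (cone T y (lift y (ehead f))) (cone_fun n f (lift y (ehead f))).
  by move=> ef; have [/cone_fun_supported] := lies_over_step cover exy ef.
rewrite cumulative_weightS ell2_sqnormD ?ell2_sqnorm_delta; last first.
  move=> v; have [->|vy] := eqVneq v y; first by right; exact: branches_apex.
  by left; rewrite /= (negPf vy).
rewrite (branches_sqnorm exy)// -sum_ratio_weight; congr (_ + _).
apply: eq_bigr => f ef; have [fyz _] := lies_over_step cover exy ef.
by rewrite (IH _ _ _ fyz).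
Qed.

(** Each level multiplies by ratio weights exactly as in [walk_weight], so only level 0 costs a
    constant; summing over the finitely many edges makes it uniform. *)
Lemma cone_err_sqnorm : exists2 K : R, 0 <= K &
  forall n e x y, lies_over T pi e x y ->
    ell2_sqnorm (cone_err n e y) <= K * walk_weight ratio_weight n e.
Proof.
pose k e := 2 * (normc (m (ehead e) (ehead e) + edge_val m (erev e) / r e) ^+ 2 +
  \sum_(f : dedge H | follows e f) normc (edge_val m (erev f)) ^+ 2).
have k0 e : 0 <= k e.
  by rewrite mulr_ge0 ?addr_ge0 ?sqr_ge0 ?sumr_ge0// => f _; rewrite sqr_ge0.
exists (\sum_e k e); first exact: sumr_ge0.
elim=> [|n IH] e x y exy /=.
  rewrite mulr1 (bigD1 e)//=.
  apply: (@le_trans _ _ (k e)); last by rewrite lerDl sumr_ge0.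
  apply: (le_trans (ell2_sqnormD_le _ _)).
  rewrite (branches_sqnorm exy); last by move=> f; exact: delta_lift_supported exy.
  rewrite ell2_sqnormZ ell2_sqnorm_delta mulr1 /k ler_pM2l// lerD2l.
  by apply: ler_sum => f _; rewrite ell2_sqnorm_delta mulr1.
rewrite (branches_sqnorm exy) => [|f ef]; last first.
  by have [fyz _] := lies_over_step cover exy ef; exact: cone_err_supported fyz.
rewrite -sum_ratio_weight mulr_sumr; apply: ler_sum => f ef.
have [fyz _] := lies_over_step cover exy ef.
by rewrite mulrCA ler_wpM2l ?sqr_ge0// (IH _ _ _ fyz).
Qed.

Lemma bounded_inverse_walk_bound : connected_graph H -> has_bounded_inverse M ->
  exists D : R, forall n e,
    cumulative_weight ratio_weight n e <= D * (1 + walk_weight ratio_weight n e).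
Proof.
move=> connH [B [[C BC] MK _]].
have [K K0 KP] := cone_err_sqnorm.
pose s e := normc (edge_val m e) ^+ 2 + normc (edge_val m (erev e) / r e) ^+ 2.
have s0 e : 0 <= s e by rewrite addr_ge0 ?sqr_ge0.
have S0 : 0 <= \sum_e s e by exact: sumr_ge0.
(* The two terms near the root pass through [ell2_sqnormD_le] twice, hence 4; the error term passes
   through it once, hence [2 * K]. *)
exists (C ^+ 2 * (4 * (\sum_e s e) + 2 * K)) => n e.
have [x [y exy]] := lies_over_surj cover connH e.
rewrite -(cone_fun_sqnorm n exy).
apply: (@le_trans _ _ (C ^+ 2 * ell2_sqnorm (M (cone_fun n e y)))).
  rewrite -!ell2_norm_sqr -exprMn -{1}(MK (cone_fun n e y)).
  have nB := BC (M (cone_fun n e y)).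
  by rewrite ler_sqr ?nnegrE ?(le_trans _ nB) ?sqrtr_ge0.
rewrite -mulrA; apply: ler_wpM2l; first exact: sqr_ge0.
rewrite (operator_cone_fun n exy).
apply: (le_trans (ell2_sqnormD_le _ _)).
have a0 : 0 <= walk_weight ratio_weight n e.
  by apply: walk_weight_ge0; exact: ratio_weight_ge0.
have := ell2_sqnormD_le (edge_val m e *: delta x)
          (- (edge_val m (erev e) / r e *: delta y)).
rewrite -scaleNr !ell2_sqnormZ !ell2_sqnorm_delta normc_opp !mulr1 -/(s e).
have := KP n _ _ _ exy.
have : s e <= \sum_e s e by rewrite (bigD1 e)//= lerDl sumr_ge0.
move: a0 S0; move: (walk_weight _ _ _) (\sum_e s e) => a S a0 S0 seS.
move: (ell2_sqnorm _) (ell2_sqnorm _) (s e) seS => X Y Z seS XK YZ.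
have := mulr_ge0 S0 a0; nra.
Qed.

End Operator.

Theorem theorem6p8 (R : realType) (W : finType) (H : sgraph W)
    (V : choiceType) (T : sgraph V) (pi : V -> W)
    (M : {linear ell2 R V -> ell2 R V}) :
  connected_graph H ->
  universal_cover T H pi ->
  bounded_op M ->
  symmetric_op M ->
  local_op T M ->
  connected_op T M ->
  pulled_back T pi M ->
  (exists r : dedge H -> R[i],
      finite_ratio_system (base_entry T pi M) r /\ decay_rate r = 1) ->
  ~ has_bounded_inverse M.
Proof.
move=> connH cover _ _ localM _ pulledM [r [ratio_r rho1]] invM.
have [D] := bounded_inverse_walk_bound cover localM pulledM ratio_r connH invM.
apply: cumulative_weight_not_bounded_by_last; first exact: ratio_weight_ge0.
by rewrite -ratio_matrixE.
Qed.
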